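(* For Banach spaces $X,Y$, the following inclusions hold between classes of bounded linear maps from $X$ to $Y$: $$\mathcal{N}(X,Y)\subset K_2(X,Y)\subset\mathfrak{K}_2(X,Y)\subset\Gamma_2(X,Y).$$
   Context: $B(X,Y)$ and $K(X,Y)$ denote bounded and compact linear maps from $X$ to $Y$; $B_X$ is the closed unit ball of $X$. $\mathcal{N}(X,Y)$ is the class of nuclear maps. $K_2(X,Y)$ is the class of $2$-compact maps (in the sense of Sinha and Karn): $T\in B(X,Y)$ such that there is a sequence $\{z_n\}$ in $Y$ with $\{\|z_n\|_Y\}\in l_2$ and $T(B_X)\subset\{\sum_{n=1}^\infty\alpha_nz_n:\sum_{n=1}^\infty|\alpha_n|^2\le1\}$. $\mathfrak{K}_2(X,Y)$ is the class of maps that are $2$-compact in the sense of Pietsch: $T\in B(X,Y)$ such that $T=B\circ A$ for some $A\in K(X,l_2)$ and $B\in K(l_2,Y)$. $\Gamma_2(X,Y)$ is the class of Hilbertian maps: $T\in B(X,Y)$ such that $T=B\circ A$ for some Hilbert space $H$, $A\in B(X,H)$ and $B\in B(H,Y)$. *)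

(* Defs.v *)
From HB Require Import structures.
From mathcomp Require Import all_boot all_order all_algebra.
From mathcomp Require Import ring.
From mathcomp Require Import sesquilinear complex.
From mathcomp Require Import all_classical all_reals all_analysis.

Set Implicit Arguments.
Unset Strict Implicit.
Unset Printing Implicit Defensive.
Import Order.TTheory GRing.Theory Num.Theory.
Import numFieldNormedType.Exports.
Local Open Scope classical_set_scope.
Local Open Scope ring_scope.
Local Open Scope complex_scope.

(* The scalars are either the real or the complex numbers. Norms of a
   [normedModType K] take their values in [K], so for complex spaces they are
   read back as real numbers through [to_real]. *)
Variant field_kind := RealScalars | ComplexScalars.

Definition scalars (R : realType) (k : field_kind) : numFieldType :=
  match k with
  | RealScalars => R
  | ComplexScalars => R[i]
  end.

Section Scalars.
Context {R : realType} {k : field_kind}.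

Definition of_real : R -> scalars R k :=
  match k return R -> scalars R k with
  | RealScalars => fun x => x
  | ComplexScalars => fun x => x%:C
  end.

Definition to_real : scalars R k -> R :=
  match k return scalars R k -> R with
  | RealScalars => fun x => x
  | ComplexScalars => fun x => complex.Re x
  end.

Definition conj : scalars R k -> scalars R k :=
  match k return scalars R k -> scalars R k with
  | RealScalars => fun x => x
  | ComplexScalars => fun x => x^*
  end.

End Scalars.

Arguments conj R k x : clear implicits.

Definition rnorm {R : realType} {k : field_kind}
  {V : normedZmodType (scalars R k)} (x : V) : R := to_real `|x|.

Section RealNorm.
Context {R : realType} {k : field_kind}.
Local Notation K := (scalars R k).

Lemma of_realK : cancel (@of_real R k) (@to_real R k).
Proof. by case: k. Qed.

Lemma of_realD : {morph (@of_real R k) : x y / x + y}.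
Proof. by case: k => x y //=; rewrite rmorphD. Qed.

Lemma of_realM : {morph (@of_real R k) : x y / x * y}.
Proof. by case: k => x y //=; rewrite rmorphM. Qed.

Lemma of_real0 : @of_real R k 0 = 0.
Proof. by case: k => //=; rewrite rmorph0. Qed.

Lemma ler_of_real : {mono (@of_real R k) : x y / x <= y}.
Proof. by case: k => x y //=; rewrite lecR. Qed.

Lemma to_realK (x : K) : 0 <= x -> of_real (to_real x) = x.
Proof.
case: k x => //= -[a b]; rewrite lecE /= => /andP[/eqP b0 _].
by rewrite b0.
Qed.

Lemma rnormE (V : normedZmodType K) (x : V) : of_real (rnorm x) = `|x|.
Proof. exact: to_realK. Qed.

Lemma rnorm_ge0 (V : normedZmodType K) (x : V) : 0 <= rnorm x.
Proof. by rewrite -ler_of_real rnormE of_real0. Qed.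

Lemma ler_rnormD (V : normedZmodType K) (x y : V) :
  rnorm (x + y) <= rnorm x + rnorm y.
Proof. by rewrite -ler_of_real of_realD !rnormE ler_normD. Qed.

Lemma rnormM (x y : K) : rnorm (x * y) = rnorm x * rnorm y.
Proof. by rewrite -[LHS]of_realK rnormE normrM -!rnormE -of_realM of_realK. Qed.

Lemma rnorm0 (V : normedZmodType K) : rnorm (0 : V) = 0.
Proof. by rewrite -[LHS]of_realK rnormE normr0 -of_real0 of_realK. Qed.

Lemma rnorm0_eq0 (V : normedZmodType K) (x : V) : rnorm x = 0 -> x = 0.
Proof.
by move=> /(congr1 (@of_real R k)); rewrite rnormE of_real0 => /normr0_eq0.
Qed.

End RealNorm.

Section SquareSummable.
Context {R : realType} {k : field_kind}.
Local Notation K := (scalars R k).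
Implicit Types (V : normedZmodType K) (a b : nat -> K).

Definition sqsum {V} (u : nat -> V) : \bar R :=
  (\sum_(n <oo) ((rnorm (u n) ^+ 2)%:E))%E.

Lemma sqsum_ge0 {V} (u : nat -> V) : (0 <= sqsum u)%E.
Proof. by apply: nneseries_ge0 => n _ _; rewrite lee_fin sqr_ge0. Qed.

Lemma sqsumZ (l : K) a :
  sqsum (fun n => l * a n) = ((rnorm l ^+ 2)%:E * sqsum a)%E.
Proof.
rewrite /sqsum -nneseriesZl; last by move=> n _; rewrite lee_fin sqr_ge0.
by apply: eq_eseriesr => n _; rewrite rnormM exprMn EFinM.
Qed.

Lemma sqsum0 {V} : sqsum (fun _ => 0 : V) = 0%E.
Proof. by apply: eseries0 => n _ _; rewrite rnorm0 expr0n. Qed.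

Lemma sqsum_eq0 {V} (u : nat -> V) : sqsum u = 0%E -> forall n, u n = 0.
Proof.
move=> u0 n; apply: rnorm0_eq0; apply/eqP; rewrite -sqrf_eq0.
rewrite eq_le sqr_ge0 andbT -lee_fin.
apply: (@le_trans _ _ (sqsum u)); last by rewrite u0.
rewrite /sqsum (@nneseriesD1 _ _ n)//; last by move=> *; rewrite lee_fin sqr_ge0.
by rewrite leeDl// nneseries_ge0// => *; rewrite lee_fin sqr_ge0.
Qed.

Lemma sqsum_split (t : R) a b : 0 < t < 1 ->
  (sqsum (fun n => a n + b n)%R <=
   (t^-1)%:E * sqsum a + ((1 - t)^-1)%R%:E * sqsum b)%E.
Proof.
move=> /andP[t0 t1]; have s0 : 0 < 1 - t by rewrite subr_gt0.
have t0' := ltW t0; have s0' := ltW s0.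
rewrite /sqsum -!nneseriesZl; try by move=> n _; rewrite lee_fin sqr_ge0.
rewrite -nneseriesD; try by move=> *;
  rewrite -EFinM lee_fin mulr_ge0 ?invr_ge0 ?sqr_ge0.
apply: lee_nneseries => n *; first by rewrite lee_fin sqr_ge0.
rewrite -!EFinM -EFinD lee_fin.
apply: (@le_trans _ _ ((rnorm (a n) + rnorm (b n)) ^+ 2)).
  by rewrite lerXn2r ?nnegrE ?addr_ge0 ?rnorm_ge0 ?ler_rnormD.
set u := rnorm (a n); set v := rnorm (b n).
rewrite -subr_ge0.
have -> : t^-1 * u ^+ 2 + (1 - t)^-1 * v ^+ 2 - (u + v) ^+ 2 =
    ((1 - t) * u - t * v) ^+ 2 / (t * (1 - t)).
  by field; rewrite !lt0r_neq0.
by rewrite divr_ge0 ?sqr_ge0// mulr_ge0.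
Qed.

(* [fine] sends +oo to 0, so this is the norm only when [sqsum a] is finite. *)
Definition l2norm a : R := Num.sqrt (fine (sqsum a)).

Lemma l2normE a : (sqsum a < +oo)%E -> sqsum a = (l2norm a ^+ 2)%:E.
Proof.
move=> afin; rewrite sqr_sqrtr ?fine_ge0 ?sqsum_ge0// fineK//.
by rewrite ge0_fin_numE ?sqsum_ge0.
Qed.

Lemma sqsumD_fin a b : (sqsum a < +oo -> sqsum b < +oo ->
  sqsum (fun n => a n + b n)%R < +oo)%E.
Proof.
move=> /l2normE afin /l2normE bfin.
have t : 0 < (2^-1 : R) < 1 by rewrite invr_gt0 invf_lt1 ?ltr1n ltr0n.
apply: le_lt_trans (sqsum_split a b t) _.
by rewrite afin bfin -!EFinM -EFinD ltry.
Qed.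

Lemma sqsumZ_fin (l : K) a :
  (sqsum a < +oo -> sqsum (fun n => l * a n)%R < +oo)%E.
Proof. by move=> /l2normE afin; rewrite sqsumZ afin -EFinM ltry. Qed.

Lemma l2norm0 a : (sqsum a < +oo)%E -> l2norm a = 0 -> forall n, a n = 0.
Proof.
by move=> afin a0; apply: sqsum_eq0; rewrite l2normE// a0 expr0n.
Qed.

Lemma l2normZ (l : K) a : (sqsum a < +oo)%E ->
  l2norm (fun n => l * a n) = rnorm l * l2norm a.
Proof.
move=> afin; rewrite {1}/l2norm sqsumZ l2normE// -EFinM/= -exprMn.
by rewrite sqrtr_sqr ger0_norm// mulr_ge0 ?rnorm_ge0 ?sqrtr_ge0.
Qed.

Lemma l2normD a b : (sqsum a < +oo)%E -> (sqsum b < +oo)%E ->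
  l2norm (fun n => a n + b n) <= l2norm a + l2norm b.
Proof.
move=> afin bfin.
have [/(l2norm0 afin) a0|a0] := eqVneq (l2norm a) 0.
  rewrite (_ : (fun n => a n + b n) = b) ?lerDr ?sqrtr_ge0//.
  by apply/funext => n; rewrite a0 add0r.
have [/(l2norm0 bfin) b0|b0] := eqVneq (l2norm b) 0.
  rewrite (_ : (fun n => a n + b n) = a) ?lerDl ?sqrtr_ge0//.
  by apply/funext => n; rewrite b0 addr0.
have {}a0 : 0 < l2norm a by rewrite lt0r a0 sqrtr_ge0.
have {}b0 : 0 < l2norm b by rewrite lt0r b0 sqrtr_ge0.
have ab0 : 0 < l2norm a + l2norm b by rewrite addr_gt0.
rewrite -(@ler_pXn2r _ 2)//; [|by rewrite nnegrE sqrtr_ge0|exact: ltW].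
rewrite -lee_fin -l2normE ?sqsumD_fin//.
pose t := l2norm a / (l2norm a + l2norm b).
have t01 : 0 < t < 1.
  by rewrite /t divr_gt0//= ltr_pdivrMr// mul1r ltrDl.
apply: le_trans (sqsum_split a b t01) _.
rewrite l2normE// [sqsum b]l2normE// -!EFinM -EFinD lee_fin.
rewrite le_eqVlt; apply/orP; left; apply/eqP.
rewrite /t; field.
by rewrite (addrC (l2norm a)) addrK !lt0r_neq0// addrC.
Qed.

End SquareSummable.

Section EllTwo.
Variables (R : realType) (k : field_kind).
Local Notation K := (scalars R k).

Definition l2_seq : {pred nat -> K^o} :=
  fun a => `[< (sqsum (a : nat -> K) < +oo)%E >].

Lemma l2_seq_submod_closed : submod_closed l2_seq.
Proof.
split=> [|l a b /asboolP afin /asboolP bfin]; apply/asboolP.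
  by rewrite (@sqsum0 R k K) ltry.
by apply: sqsumD_fin => //; exact: sqsumZ_fin.
Qed.

HB.instance Definition _ :=
  GRing.isSubmodClosed.Build K (nat -> K^o) l2_seq l2_seq_submod_closed.

Record l2 := L2 { l2val :> nat -> K^o; l2valP : l2val \in l2_seq }.

HB.instance Definition _ := [isSub for l2val].
HB.instance Definition _ := [Choice of l2 by <:].
HB.instance Definition _ := [SubChoice_isSubLmodule of l2 by <:].

Let l2fin (a : l2) : (sqsum (l2val a : nat -> K) < +oo)%E.
Proof. exact/asboolP/l2valP. Qed.

Let nm (a : l2) : K := of_real (l2norm (l2val a : nat -> K)).

Let nmD a b : nm (a + b) <= nm a + nm b.
Proof. by rewrite -of_realD ler_of_real l2normD. Qed.

Let nmZ (l : K) a : nm (l *: a) = `|l| * nm a.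
Proof. by rewrite -rnormE -of_realM -l2normZ. Qed.

Let nm0 a : nm a = 0 -> a = 0.
Proof.
move=> /(congr1 to_real); rewrite -of_real0 !of_realK => /l2norm0 a0.
by apply/val_inj/funext => n /=; rewrite a0.
Qed.

HB.instance Definition _ := @Lmodule_isNormed.Build K l2 nm nmD nmZ nm0.

Lemma l2_normE (a : l2) : `|a| = of_real (l2norm (l2val a : nat -> K)).
Proof. by []. Qed.

End EllTwo.

Section OperatorClasses.
Context {R : realType} {k : field_kind}.
Local Notation K := (scalars R k).

Definition unit_ball (X : normedModType K) : set X := [set x | `|x| <= 1].
Arguments unit_ball X : clear implicits.

Definition bounded_map (X Y : normedModType K) : set {linear X -> Y} :=
  [set T | exists M : K, forall x, `|T x| <= M * `|x|].
Arguments bounded_map X Y : clear implicits.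

Definition compact_map (X Y : normedModType K) : set {linear X -> Y} :=
  [set T | precompact (T @` unit_ball X)].
Arguments compact_map X Y : clear implicits.

(* Only meaningful for bounded [T]: the supremum of an unbounded set is 0. *)
Definition opnorm (X Y : normedModType K) (T : {linear X -> Y}) : R :=
  sup [set rnorm (T x) | x in unit_ball X].

Definition nuclear_map (X Y : normedModType K) : set {linear X -> Y} :=
  [set T | bounded_map X Y T /\
    exists (f : nat -> {linear X -> K^o}) (y : nat -> Y),
    [/\ forall n, bounded_map X K^o (f n),
        (\sum_(n <oo) (opnorm (f n) * rnorm (y n))%:E < +oo)%E &
        forall x, series (fun n => f n x *: y n) @ \oo --> T x]].
Arguments nuclear_map X Y : clear implicits.

Definition two_compact_map (X Y : normedModType K) : set {linear X -> Y} :=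
  [set T | bounded_map X Y T /\
    exists2 z : nat -> Y, (sqsum z < +oo)%E &
    T @` unit_ball X `<=`
      [set y | exists2 a : nat -> K, (sqsum a <= 1)%E &
                 series (fun n => a n *: z n) @ \oo --> y]].
Arguments two_compact_map X Y : clear implicits.

Definition pietsch_two_compact_map (X Y : normedModType K) :
    set {linear X -> Y} :=
  [set T | bounded_map X Y T /\
    exists (A : {linear X -> l2 R k}) (B : {linear l2 R k -> Y}),
    [/\ compact_map X (l2 R k) A, compact_map (l2 R k) Y B &
        forall x, T x = B (A x)]].
Arguments pietsch_two_compact_map X Y : clear implicits.

(* The form [dot] is linear in its first argument, conjugate-linear in its
   second one, Hermitian and positive definite. *)
Definition is_hilbert (H : completeNormedModType K) :=
  exists dot : {dot H for conj R k}, forall x, `|x| ^+ 2 = dot x x.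

Definition hilbertian_map (X Y : normedModType K) : set {linear X -> Y} :=
  [set T | bounded_map X Y T /\
    exists (H : completeNormedModType K) (A : {linear X -> H})
           (B : {linear H -> Y}),
    [/\ is_hilbert H, bounded_map X H A, bounded_map H Y B &
        forall x, T x = B (A x)]].
Arguments hilbertian_map X Y : clear implicits.

End OperatorClasses.

Arguments unit_ball {R k} X.
Arguments bounded_map {R k} X Y.
Arguments compact_map {R k} X Y.
Arguments nuclear_map {R k} X Y.
Arguments two_compact_map {R k} X Y.
Arguments pietsch_two_compact_map {R k} X Y.
Arguments hilbertian_map {R k} X Y.

(* Main.v *)
From HB Require Import structures.
Require Import Defs.
From mathcomp Require Import all_boot all_order all_algebra.
From mathcomp Require Import sesquilinear complex.
From mathcomp Require Import all_classical all_reals all_analysis.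
From mathcomp Require Import ring lra.
Set Implicit Arguments.
Unset Strict Implicit.
Unset Printing Implicit Defensive.
Import Order.TTheory GRing.Theory Num.Theory.
Import numFieldNormedType.Exports.
Local Open Scope classical_set_scope.
Local Open Scope ring_scope.

(** A nuclear map is a sum of rank-one maps [f n x *: y n] with
[\sum_n |f n| |y n|] finite. Splitting the weight [|f n| |y n|] evenly, as a
product of two square roots, between the functional and the vector makes the
coefficients and the vectors both square summable, which is a 2-compact
representation (lemma [nuclear_two_compact]).

Suppose now that [T] maps the unit ball into the combinations
[\sum_n a n *: z n] with [a] in the unit ball of [l2] and [z] square summable.
The synthesis map [B0 a = \sum_n a n *: z n] is bounded on [l2]
([comb_linear], [comb_bounded]), and every [T x] has a [B0]-preimage of norm at
most [|x|]. Among the preimages of [T x] the one orthogonal to the kernel of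
[B0] is unique and of least norm, hence depends linearly and contractively on
[x]: this gives [A0] with [T = B0 \o A0] ([hilbert_lift]). Both factors are then
made compact at once. A square summable sequence stays square summable after
division by suitable weights [d n] that tend to zero ([vanishing_weights]), so
[B0 = B \o S] where [S] is the diagonal map of [d], which is compact because
[d] vanishes at infinity ([diagonal_compact]), and [B] is the synthesis map of
[(d n)^-1 *: z n], which is compact like every synthesis map of a square
summable sequence ([comb_compact]). Thus [T = B \o (S \o A0)]
([two_compact_pietsch]).

Finally compact maps are bounded and [l2] is a Hilbert space ([l2_hilbert]), so
a factorization through [l2] by compact maps is a Hilbertian one.

Compactness is always obtained in the same way: in a complete space, a set that
is within [e] of a compact set for every [e] is relatively compact
([precompact_approx]). The real and the complex scalars are treated together:
they enter through the fact that a disc of scalars lies in a compact set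
([scalar_disc_compact]), which also yields their completeness. *)

(** * Real-valued norms *)

Section RealNorms.
Context {R : realType} {k : field_kind}.
Local Notation K := (scalars R k).

Lemma ltr_of_real (x y : R) : (@of_real R k x < of_real y) = (x < y).
Proof. by rewrite !lt_neqAle ler_of_real (inj_eq (can_inj of_realK)). Qed.

Lemma of_real_ge0 (x : R) : (0 <= @of_real R k x) = (0 <= x).
Proof. by rewrite -{1}of_real0 ler_of_real. Qed.

Lemma of_real_gt0 (x : R) : (0 < @of_real R k x) = (0 < x).
Proof. by rewrite -{1}of_real0 ltr_of_real. Qed.

Lemma of_real1 : @of_real R k 1 = 1.
Proof. by case: k. Qed.

Lemma of_real_nat (n : nat) : @of_real R k n%:R = n%:R.
Proof.
elim: n => [|n IH]; first exact: of_real0.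
by rewrite -[n.+1]addn1 !natrD of_realD IH of_real1.
Qed.

Lemma of_realN (x : R) : @of_real R k (- x) = - of_real x.
Proof. by apply/eqP; rewrite -addr_eq0 -of_realD addNr of_real0. Qed.

Lemma to_real_gt0 (e : K) : 0 < e -> 0 < to_real e.
Proof. by move=> e0; rewrite -of_real_gt0 to_realK// ltW. Qed.

Lemma eq_rnorm (U V : normedZmodType K) (x : U) (y : V) :
  `|x| = `|y| -> rnorm x = rnorm y.
Proof. by rewrite /rnorm => ->. Qed.

Lemma rnorm_gt0 (V : normedZmodType K) (x : V) : x != 0 -> 0 < rnorm x.
Proof.
move=> x0; rewrite lt0r rnorm_ge0 andbT.
by apply: contra_neq x0; exact: rnorm0_eq0.
Qed.

Lemma rnormN (V : normedZmodType K) (x : V) : rnorm (- x) = rnorm x.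
Proof. by apply: eq_rnorm; rewrite normrN. Qed.

Lemma rdistC (V : normedZmodType K) (x y : V) : rnorm (x - y) = rnorm (y - x).
Proof. by rewrite -rnormN opprB. Qed.

Lemma ler_rdistD (V : normedZmodType K) (y x z : V) :
  rnorm (x - z) <= rnorm (x - y) + rnorm (y - z).
Proof. by apply: le_trans (ler_rnormD _ _); rewrite addrA subrK. Qed.

Lemma ler_rnormB (V : normedZmodType K) (x y : V) :
  rnorm (x - y) <= rnorm x + rnorm y.
Proof. by apply: le_trans (ler_rnormD _ _) _; rewrite rnormN. Qed.

Lemma rnorm_of_real (x : R) : rnorm (of_real x : K) = `|x|.
Proof.
have pos (y : R) : 0 <= y -> rnorm (of_real y : K) = y.
  by move=> y0; rewrite /rnorm ger0_norm ?of_real_ge0// of_realK.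
have [x0|x0] := leP 0 x; first by rewrite pos ?ger0_norm.
by rewrite -rnormN -of_realN pos ?ltr0_norm ?oppr_ge0 ?ltW.
Qed.

Lemma rnormZ (V : normedModType K) (a : K) (x : V) :
  rnorm (a *: x) = rnorm a * rnorm x.
Proof.
by rewrite -[LHS](@of_realK R k) rnormE normrZ -!rnormE -of_realM of_realK.
Qed.

Lemma ler_rnorm_sum (V : normedZmodType K) (u : nat -> V) (m n : nat) :
  rnorm (\sum_(m <= i < n) u i) <= \sum_(m <= i < n) rnorm (u i).
Proof.
elim/big_ind2: _ => [|x r y s xr ys|//]; first by rewrite rnorm0.
by apply: le_trans (ler_rnormD _ _) _; exact: lerD.
Qed.

Lemma unit_ballP (V : normedModType K) (x : V) : unit_ball V x <-> rnorm x <= 1.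
Proof. by rewrite /unit_ball /= -rnormE -of_real1 ler_of_real. Qed.

Lemma cvg_rnormP (V : normedModType K) (T : Type) (F : set_system T)
    {FF : Filter F} (f : T -> V) (y : V) :
  f @ F --> y <-> forall e : R, 0 < e -> \forall t \near F, rnorm (y - f t) < e.
Proof.
split=> [/cvgrPdist_lt fy e e0|fy].
  have := fy (of_real e); rewrite of_real_gt0 => /(_ e0).
  by apply: filterS => t; rewrite -rnormE ltr_of_real.
apply/cvgrPdist_lt => e e0.
have := fy _ (to_real_gt0 e0); apply: filterS => t.
by rewrite -ltr_of_real rnormE to_realK// ltW.
Qed.

Lemma cvg_rnorm (V : normedModType K) (T : Type) (F : set_system T)
    {FF : Filter F} (f : T -> V) (y : V) :
  f @ F --> y -> (fun t => rnorm (f t)) @ F --> rnorm y.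
Proof.
move=> /cvg_rnormP fy; apply/cvgrPdist_lt => e /fy; apply: filterS => t.
have yft : rnorm y <= rnorm (y - f t) + rnorm (f t).
  by rewrite -{1}(subrK (f t) y) ler_rnormD.
have fty : rnorm (f t) <= rnorm (y - f t) + rnorm y.
  by rewrite rdistC -{1}(subrK y (f t)) ler_rnormD.
by apply: le_lt_trans; rewrite ler_norml; apply/andP; split; lra.
Qed.

Lemma nbhs_rdist (V : normedModType K) (y : V) (e : R) :
  0 < e -> nbhs y [set z | rnorm (y - z) < e].
Proof.
move=> e0; apply/nbhs_ballP; exists (of_real e); first by rewrite /= of_real_gt0.
by move=> z; rewrite -ball_normE /ball_ /= -rnormE ltr_of_real.
Qed.

Lemma cauchy_rnorm (V : normedModType K) (F : set_system V) {FF : Filter F} :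
  (forall e : R, 0 < e -> exists x, F [set y | rnorm (x - y) < e]) -> cauchy F.
Proof.
move=> Fe; apply: cauchy_exP => e e0.
have [x Fx] := Fe _ (to_real_gt0 e0); exists x.
apply: filterS Fx => y /=; rewrite -ball_normE /ball_ /=.
by rewrite -ltr_of_real rnormE to_realK// ltW.
Qed.

Lemma rnorm_cauchy (V : normedModType K) (F : set_system V)
    {FF : ProperFilter F} : cauchy F ->
  forall e : R, 0 < e -> exists x, F [set y | rnorm (x - y) < e].
Proof.
move=> /cauchyP Fe e e0.
have [|x Fx] := Fe (of_real e); first by rewrite of_real_gt0.
exists x; apply: filterS Fx => y; rewrite -ball_normE /ball_ /=.
by rewrite -rnormE ltr_of_real.
Qed.

(** A limit inherits non-strict bounds on the distance to a fixed vector. *)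
Lemma rdist_lim_le (V : normedModType K) (T : Type) (F : set_system T)
    {FF : ProperFilter F} (f : T -> V) (y c : V) (M : R) :
  f @ F --> y -> (\forall t \near F, rnorm (f t - c) <= M) -> rnorm (y - c) <= M.
Proof.
move=> /cvg_rnormP fy fM; apply/ler_addgt0Pr => e e0.
have [t [ft ftM]] := filter_ex (filterI (fy _ e0) fM).
rewrite [leRHS]addrC; apply: le_trans (ler_rdistD (f t) _ _) _.
by apply: lerD => //; exact: ltW.
Qed.

Lemma seq_lim_unique (V : normedModType K) (u : nat -> V) (y z : V) :
  u @ \oo --> y -> u @ \oo --> z -> y = z.
Proof.
move=> /(cvg_lim (@norm_hausdorff _ V)) <- /(cvg_lim (@norm_hausdorff _ V)) <-.
by [].
Qed.

Lemma linear_of (U V : lmodType K) (f : U -> V) : linear f ->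
  exists T : {linear U -> V}, T =1 f.
Proof.
move=> f_lin; pose m := GRing.isLinear.Build K U V *:%R f f_lin.
by exists (HB.pack f m : {linear U -> V}).
Qed.

(** Completeness as a property rather than a structure, so that the lemmas
below apply to the scalars and to [l2] as well as to Banach spaces. *)
Definition cauchy_complete (V : normedModType K) :=
  forall F : set_system V, ProperFilter F -> cauchy F -> cvg F.

Lemma completeNormedMod_cauchy (V : completeNormedModType K) : cauchy_complete V.
Proof. by move=> F FF; exact: cauchy_cvg. Qed.

Lemma cauchy_seq_cvg (V : normedModType K) (u : nat -> V) :
  cauchy_complete V ->
  (forall e : R, 0 < e -> exists N, forall n, (N <= n)%N -> rnorm (u n - u N) < e) ->
  cvg (u @ \oo).
Proof.
move=> cV uC; apply: cV; apply: cauchy_rnorm => e e0.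
have [N uN] := uC _ e0; exists (u N); exists N => // n /= Nn.
by rewrite rdistC uN.
Qed.

Lemma bounded_mapP (X Y : normedModType K) (T : {linear X -> Y}) :
  bounded_map X Y T <->
  exists2 M : R, 0 < M & forall x, rnorm (T x) <= M * rnorm x.
Proof.
split=> [[M TM]|[M M0 TM]]; last first.
  by exists (of_real M) => x; rewrite -!rnormE -of_realM ler_of_real.
exists (rnorm M + 1) => [|x]; first by rewrite ltr_wpDl ?rnorm_ge0.
rewrite -(@ler_of_real R k) of_realM !rnormE of_realD rnormE of_real1.
have [x0|x0] := eqVneq x 0; first by rewrite x0 linear0 !normr0 mulr0.
have nx : 0 < `|x| by rewrite normr_gt0.
have M0 : 0 <= M by rewrite -(pmulr_lge0 _ nx); exact: le_trans (TM x).
apply: le_trans (TM x) _; rewrite ler_pM2r// ger0_norm// lerDl//.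
Qed.

(** By homogeneity it is enough to bound an operator on the unit ball. *)
Lemma bounded_on_ball (X Y : normedModType K) (T : {linear X -> Y}) (M : R) :
  0 < M -> (forall x, unit_ball X x -> rnorm (T x) <= M) ->
  forall x, rnorm (T x) <= M * rnorm x.
Proof.
move=> M0 TM x; have [->|x0] := eqVneq x 0.
  by rewrite linear0 !rnorm0 mulr0.
have nx := rnorm_gt0 x0.
have := TM (of_real (rnorm x)^-1 *: x); rewrite linearZ/= !rnormZ.
rewrite rnorm_of_real ger0_norm ?invr_ge0 ?rnorm_ge0// => TMx.
rewrite -ler_pdivrMr// mulrC; apply: TMx; apply/unit_ballP.
by rewrite rnormZ rnorm_of_real ger0_norm ?invr_ge0 ?rnorm_ge0// mulVf// gt_eqF.
Qed.

Lemma bounded_map_cvg (X Y : normedModType K) (T : {linear X -> Y})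
    (I : Type) (F : set_system I) {FF : Filter F} (u : I -> X) (x : X) :
  bounded_map X Y T -> u @ F --> x -> (T \o u) @ F --> T x.
Proof.
move=> /bounded_mapP[M M0 TM] /cvg_rnormP ux; apply/cvg_rnormP => e e0.
have := ux (e / M); rewrite divr_gt0// => /(_ isT).
apply: filterS => t; rewrite ltr_pdivlMr// mulrC /= -linearB.
exact: le_lt_trans.
Qed.

End RealNorms.

(** * Compactness and completeness of the scalars *)

Section Scalars.
Variable R : realType.

(** In the complex case the compact set is the square circumscribed about the
disc. *)
Lemma scalar_disc_compact (k : field_kind) (M : R) :
  exists2 C : set (scalars R k)^o, compact C & forall x, rnorm x <= M -> C x.
Proof.
case: k => /=.
  exists `[- M, M]%classic => [|x]; first exact: segment_compact.
  by rewrite /rnorm /= in_itv /= ler_norml.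
pose f (p : R * R) : R[i]^o :=
  @of_real R ComplexScalars p.1 + 'i%C * @of_real R ComplexScalars p.2.
have norm_i : @rnorm R ComplexScalars _ ('i%C : R[i]) = 1.
  by rewrite /rnorm /= expr0n expr1n add0r sqrtr1.
exists (f @` (`[- M, M]%classic `*` `[- M, M]%classic)).
  apply: continuous_compact; last first.
    by apply: compact_setX; exact: segment_compact.
  apply: continuous_subspaceT => p.
  apply/(@cvg_rnormP R ComplexScalars) => e e0.
  have e2 : 0 < e / 2 by rewrite divr_gt0.
  have p1 : (fun q : R * R => q.1) @ p --> p.1 by exact: cvg_fst.
  have p2 : (fun q : R * R => q.2) @ p --> p.2 by exact: cvg_snd.
  near=> q; have q1 : `|p.1 - q.1| < e / 2 by near: q; move/cvgrPdist_lt: p1 => /(_ _ e2).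
  have q2 : `|p.2 - q.2| < e / 2 by near: q; move/cvgrPdist_lt: p2 => /(_ _ e2).
  have -> : f p - f q = @of_real R ComplexScalars (p.1 - q.1) +
      'i%C * @of_real R ComplexScalars (p.2 - q.2).
    by rewrite /f !of_realD !of_realN; ring.
  apply: le_lt_trans (ler_rnormD _ _) _.
  by rewrite rnormM norm_i mul1r !rnorm_of_real [e]splitr ltrD.
move=> [a b] abM; exists (a, b); last first.
  by rewrite /f /=; apply/eqP; rewrite eq_complex /= !(mul0r,mul1r,addr0,add0r,subr0,mulr0) !eqxx.
have le_sqrt (x y : R) : `|x| <= Num.sqrt (x ^+ 2 + y ^+ 2).
  by rewrite -sqrtr_sqr ler_wsqrtr// lerDl sqr_ge0.
move: abM; rewrite /rnorm /= => abM.
split; rewrite /= in_itv /= -ler_norml; apply: le_trans abM => //.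
by rewrite addrC.
Unshelve. all: by end_near. Qed.

(** A Cauchy filter contains a disc, hence a compact set. *)
Lemma scalars_complete (k : field_kind) : @cauchy_complete R k (scalars R k)^o.
Proof.
move=> F FF cF; have [x Fx] := rnorm_cauchy cF ltr01.
have [C cC CM] := scalar_disc_compact k (rnorm x + 1).
apply: (compact_cauchy_cvg FF cF _ cC); apply: filterS Fx => y /= xy.
apply: CM; rewrite -[y](subKr x); apply: le_trans (ler_rnormB _ _) _.
by rewrite lerD2l ltW.
Qed.

End Scalars.

(** * Compact operators *)

Section Compactness.
Context {R : realType} {k : field_kind}.
Local Notation K := (scalars R k).

(** Total boundedness in a form adapted to limits of finite-rank operators. For
an ultrafilter on the closure of [A], move each point to a nearby point [g y]
of a compact set; the moved ultrafilter clusters at some [c], hence the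
original one has a member within [e] of [c], and so it is Cauchy. *)
Lemma precompact_approx (Y : normedModType K) (A : set Y) :
  cauchy_complete Y ->
  (forall e : R, 0 < e -> exists2 C : set Y, compact C &
     forall y, A y -> exists2 c, C c & rnorm (y - c) < e) ->
  precompact A.
Proof.
move=> cY Aapprox; rewrite precompactE compact_ultra => F UF FA.
have FF : ProperFilter F by exact: ultra_proper.
have cF : cauchy F.
  apply: cauchy_rnorm => e e0.
  have e4 : 0 < e / 2 / 2 by rewrite !divr_gt0.
  have [C cC AC] := Aapprox _ e4.
  have /choice[g gP] (y : Y) :
      exists c : Y, closure A y -> C c /\ rnorm (y - c) < e / 2.
    have [clAy|nAy] := pselect (closure A y); last by exists 0.
    have [|a [Aa /= ya]] := clAy [set a | rnorm (y - a) < e / 2 / 2].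
      exact: nbhs_rdist.
    have [c Cc ac] := AC _ Aa; exists c => _; split=> //.
    apply: le_lt_trans (ler_rdistD a _ _) _.
    by rewrite [e / 2]splitr ltrD.
  have FgC : (g @ F) C by apply: (@filterS _ F _ _ _ _ FA) => y /gP[].
  have [c [_ gc]] := cC (g @ F) _ FgC; exists c.
  have e2 : 0 < e / 2 by rewrite divr_gt0.
  have Fgc : F [set y | rnorm (c - g y) < e / 2].
    (* otherwise the complement is in [F], and [c] would not be a cluster point *)
    have [//|FN] := in_ultra_setVsetC [set y | rnorm (c - g y) < e / 2] UF.
    have [z [/=]] := gc (~` [set z | rnorm (c - z) < e / 2]) _ FN (nbhs_rdist _ e2).
    by [].
  apply: (filterS _ (filterI FA Fgc)) => y [/gP[_ yg] cg] /=.
  apply: le_lt_trans (ler_rdistD (g y) _ _) _.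
  by rewrite [e]splitr ltrD// rdistC.
have Fp : F --> lim F := cY F FF cF.
exists (lim F); split=> //.
exact: (@closed_cvg _ _ F _ id _ (@closed_closure _ A) FA _ Fp).
Qed.

(** The set of these sums is a finite Minkowski sum of compact sets. *)
Lemma compact_combinations (Y : normedModType K) (v : nat -> Y) (M : R) (N : nat) :
  exists2 C : set Y, compact C &
    forall a : nat -> K, (forall n, rnorm (a n) <= M) ->
      C (\sum_(0 <= n < N) a n *: v n).
Proof.
have [D cD DM] := scalar_disc_compact k M.
elim: N => [|N [C cC CN]].
  by exists [set 0] => [|a _]; [exact: compact_set1|rewrite big_geq].
exists ((fun p : Y * K^o => p.1 + p.2 *: v N) @` (C `*` D)) => [|a aM].
  apply: continuous_compact; last exact: compact_setX.
  apply: continuous_subspaceT => p; apply: cvgD; first exact: cvg_fst.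
  by apply: cvgZr_tmp; exact: cvg_snd.
by exists (\sum_(0 <= n < N) a n *: v n, a N);
  [split; [exact: CN|exact: (DM (a N) (aM N))]|rewrite big_nat_recr].
Qed.

(** Uniform limits of finite-rank maps are compact. *)
Lemma compact_map_approx (X Y : normedModType K) (T : {linear X -> Y})
    (phi : nat -> X -> K) (v : nat -> Y) (M : R) :
  cauchy_complete Y ->
  (forall n x, unit_ball X x -> rnorm (phi n x) <= M) ->
  (forall e : R, 0 < e -> exists N, forall x, unit_ball X x ->
     rnorm (T x - \sum_(0 <= n < N) phi n x *: v n) < e) ->
  compact_map X Y T.
Proof.
move=> cY phiM Tphi; apply: precompact_approx => // e /Tphi[N TN].
have [C cC CN] := compact_combinations v M N; exists C => // _ [x Bx <-].
exists (\sum_(0 <= n < N) phi n x *: v n); last exact: TN.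
by apply: (CN (phi ^~ x)) => n; exact: phiM.
Qed.

Lemma compact_map_bounded (X Y : normedModType K) (T : {linear X -> Y}) :
  compact_map X Y T -> bounded_map X Y T.
Proof.
case=> C TC [cC _]; suff [n Cn] : exists n : nat, forall y, C y -> rnorm y <= n%:R.
  apply/bounded_mapP; exists n.+1%:R => //; apply: bounded_on_ball => // x Bx.
  rewrite (@le_trans _ _ n%:R) ?ler_nat//; apply/Cn/TC.
  by exists x.
move: cC; rewrite compact_cover => /(_ nat setT (fun n => [set y | rnorm y < n%:R])).
case=> [n _|y Cy|D _ CD].
- rewrite openE => y /= yn; rewrite /interior /=.
  have /filterS : nbhs y [set z | rnorm (y - z) < n%:R - rnorm y].
    by apply: nbhs_rdist; rewrite subr_gt0.
  apply=> z yz /=.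
  rewrite -[z](subKr y); apply: le_lt_trans (ler_rnormB _ _) _.
  by rewrite addrC -ltrBrDr.
- by exists (Num.truncn (rnorm y)).+1 => //=; rewrite truncnS_gt.
exists (\max_(i <- finmap.enum_fset D) i)%N => y /CD[n Dn /= /ltW yn].
by apply: le_trans yn _; rewrite ler_nat (leq_bigmax_seq n).
Qed.

End Compactness.

(** * Square-summable sequences *)

Section NonnegativeSeries.
Variables (R : realType) (p : nat -> R).
Hypothesis p0 : forall n, 0 <= p n.

Lemma nneseries_leP (M : R) : (\sum_(n <oo) (p n)%:E <= M%:E)%E <->
  forall N, \sum_(0 <= n < N) p n <= M.
Proof.
split=> [pM N|pM].
  rewrite -lee_fin -sumEFin; apply: le_trans pM.
  by apply: nneseries_lim_ge => n _ _; rewrite lee_fin.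
apply: lime_le; first by apply: is_cvg_nneseries => n _ _; rewrite lee_fin.
by apply: nearW => N; rewrite sumEFin lee_fin.
Qed.

(** With [nneseries_leP], this moves summability from extended-real series to
bounds on real partial sums. *)
Lemma nneseries_finP : (\sum_(n <oo) (p n)%:E < +oo)%E <->
  exists M, forall N, \sum_(0 <= n < N) p n <= M.
Proof.
split=> [pfin|[M /nneseries_leP pM]]; last exact: le_lt_trans pM (ltry _).
have ge0 : (0 <= \sum_(n <oo) (p n)%:E)%E.
  by apply: nneseries_ge0 => n _ _; rewrite lee_fin.
exists (fine (\sum_(n <oo) (p n)%:E)%E); apply/nneseries_leP.
by rewrite fineK// ge0_fin_numE.
Qed.

Lemma nnseries_tail (M e : R) : 0 < e ->
  (forall N, \sum_(0 <= n < N) p n <= M) ->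
  exists N, forall m n, (N <= m)%N -> \sum_(m <= i < n) p i < e.
Proof.
move=> e0 pM; pose S := [set \sum_(0 <= n < N) p n | N in setT].
have supS : has_sup S.
  by split; [exists (\sum_(0 <= n < 0) p n); exists 0%N|exists M => _ [N _ <-]].
have [_ [N _ <-] supN] := sup_adherent e0 supS.
exists N => m n Nm; have [mn|nm] := leqP m n; last first.
  by rewrite big_geq// ltnW.
have : \sum_(0 <= i < n) p i <= sup S by apply: sup_upper_bound => //; exists n.
rewrite (big_cat_nat (leq0n m) mn)/= (big_cat_nat (leq0n N) Nm)/=.
have : 0 <= \sum_(N <= i < m) p i by exact: sumr_ge0.
move: supN; lra.
Qed.

End NonnegativeSeries.

Lemma cauchy_schwarz_range (R : realType) (a b : nat -> R) (m n : nat) :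
  \sum_(m <= i < n) a i * b i <=
  Num.sqrt (\sum_(m <= i < n) a i ^+ 2) * Num.sqrt (\sum_(m <= i < n) b i ^+ 2).
Proof.
have [nm|] := leqP n m; first by rewrite !big_geq// sqrtr0 mul0r.
elim: n => // n IH; rewrite ltnS leq_eqVlt => /predU1P[<-|mn].
  by rewrite !big_nat1 !sqrtr_sqr -normrM ler_norm.
have {IH} := IH mn; have mn' := ltnW mn.
rewrite !big_nat_recr//=.
(* with [s] and [t] the two previous square roots, the induction step is
   the positivity of the square of [s * b n - t * a n] *)
set A := \sum_(m <= i < n) a i ^+ 2; set B := \sum_(m <= i < n) b i ^+ 2.
set C := \sum_(m <= i < n) a i * b i.
have A0 : 0 <= A by apply: sumr_ge0 => i _; exact: sqr_ge0.
have B0 : 0 <= B by apply: sumr_ge0 => i _; exact: sqr_ge0.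
move=> CAB; rewrite -sqrtrM ?addr_ge0 ?sqr_ge0//.
set s := Num.sqrt A in CAB; set t := Num.sqrt B in CAB.
apply: (@le_trans _ _ (s * t + a n * b n)); first by rewrite lerD2r.
apply: le_trans (ler_norm _) _; rewrite -sqrtr_sqr ler_wsqrtr//.
rewrite -(sqr_sqrtr A0) -(sqr_sqrtr B0) -/s -/t -subr_ge0.
rewrite (_ : _ - _ = (s * b n - t * a n) ^+ 2) ?sqr_ge0//; ring.
Qed.

(** * The space of square-summable sequences *)

Section L2.
Context {R : realType} {k : field_kind}.
Local Notation K := (scalars R k).
Local Notation l2 := (l2 R k).

(** Coordinates typed in the field of scalars instead of its regular module. *)
Definition coord (a : l2) (n : nat) : K := l2val a n.
Arguments coord : simpl never.

Lemma coordD (a b : l2) n : coord (a + b) n = coord a n + coord b n.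
Proof. by []. Qed.

Lemma coordB (a b : l2) n : coord (a - b) n = coord a n - coord b n.
Proof. by []. Qed.

Lemma coordZ (l : K) (a : l2) n : coord (l *: a) n = l * coord a n.
Proof. by []. Qed.

Lemma sqsum_coord (a : l2) : sqsum (coord a) = (rnorm a ^+ 2)%:E.
Proof.
have afin : (sqsum (coord a) < +oo)%E by exact/asboolP/l2valP.
by rewrite (l2normE afin) /rnorm l2_normE of_realK.
Qed.

Lemma sum_coord_le (a : l2) N :
  \sum_(0 <= n < N) rnorm (coord a n) ^+ 2 <= rnorm a ^+ 2.
Proof.
move: N; apply/nneseries_leP => [n|]; first exact: sqr_ge0.
by rewrite -sqsum_coord.
Qed.

Lemma l2_rnorm_le (a : l2) (M : R) : 0 <= M ->
  (forall N, \sum_(0 <= n < N) rnorm (coord a n) ^+ 2 <= M ^+ 2) -> rnorm a <= M.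
Proof.
move=> M0 aM; rewrite -(@ler_pXn2r _ 2) ?nnegrE ?rnorm_ge0// -lee_fin.
by rewrite -sqsum_coord; apply/nneseries_leP => // n; exact: sqr_ge0.
Qed.

Lemma rnorm_coord_le (a : l2) n : rnorm (coord a n) <= rnorm a.
Proof.
rewrite -(@ler_pXn2r _ 2) ?nnegrE ?rnorm_ge0//.
apply: le_trans (sum_coord_le a n.+1).
by rewrite big_nat_recr//= lerDr sumr_ge0// => i _; exact: sqr_ge0.
Qed.

Lemma l2_of_seq (a : nat -> K) (M : R) :
  (forall N, \sum_(0 <= n < N) rnorm (a n) ^+ 2 <= M) ->
  exists b : l2, forall n, coord b n = a n.
Proof.
move=> aM; have aP : (a : nat -> K^o) \in (@l2_seq R k).
  apply/asboolP/nneseries_finP; first by move=> n; exact: sqr_ge0.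
  by exists M.
by exists (L2 aP).
Qed.

(** A Cauchy filter converges coordinatewise, to [c] say. The estimate
[dist_le] passes to the limit in finitely many coordinates at a time, which
gives both the convergence in norm and the square summability of [c]: the
latter because [c] differs from the member [a0] by the element [d] of [l2]. *)
Lemma l2_complete : @cauchy_complete R k l2.
Proof.
move=> F FF cF; have Fe := @rnorm_cauchy R k _ F FF cF.
have coord_cvg n : {c : K | (fun a => coord a n : K^o) @ F --> (c : K^o)}.
  have : cauchy ((fun a => coord a n : K^o) @ F).
    apply: (@cauchy_rnorm R k K^o) => e e0.
    have [a Fa] := Fe _ e0; exists (coord a n : K^o).
    apply: (@filterS _ F _ _ _ _ Fa) => b /=; apply: le_lt_trans.
    by rewrite -coordB; exact: rnorm_coord_le.
  move=> /scalars_complete Fn.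
  by exists (lim ((fun a => coord a n : K^o) @ F)); exact: Fn.
pose c n := sval (coord_cvg n).
have dist_le a e : 0 < e -> F [set b | rnorm (a - b) < e] -> forall N,
    \sum_(0 <= n < N) rnorm (coord a n - c n) ^+ 2 <= e ^+ 2.
  move=> e0 Fa N.
  pose f b := \sum_(0 <= n < N) rnorm (coord a n - coord b n) ^+ 2.
  have fc : f @ F --> \sum_(0 <= n < N) rnorm (coord a n - c n) ^+ 2.
    apply: cvg_big => [|n _]; first exact: add_continuous.
    have : (fun b => rnorm (coord a n - coord b n)) @ F --> rnorm (coord a n - c n).
      apply: (@cvg_rnorm R k K^o); apply: cvgB; [exact: cvg_cst|].
      exact: (svalP (coord_cvg n)).
    by move=> /[dup]; exact: cvgM.
  apply: (closed_cvg _ (@closed_le _ (e ^+ 2)) _ _ fc).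
  apply: filterS Fa => b ab /=; apply: le_trans (sum_coord_le (a - b) N) _.
  by rewrite ler_pXn2r ?nnegrE ?rnorm_ge0 ?ltW.
have [a0 Fa0] := Fe _ ltr01.
have [d dc] := l2_of_seq (dist_le _ _ ltr01 Fa0).
apply/cvg_ex; exists (a0 - d); apply/cvg_rnormP => e e0.
have e2 : 0 < e / 2 by rewrite divr_gt0.
have [a Fa] := Fe _ e2; apply: (filterS _ Fa) => b ab.
apply: le_lt_trans (ler_rdistD a _ _) _.
rewrite [e]splitr ler_ltD// rdistC; apply: l2_rnorm_le; first exact: ltW.
move=> N; apply: le_trans (dist_le _ _ e2 Fa N).
rewrite le_eqVlt; apply/orP; left; apply/eqP/eq_bigr => n _.
by rewrite !coordB dc subKr.
Qed.

HB.instance Definition _ := Uniform_isComplete.Build l2 l2_complete.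

End L2.

(** * Synthesis maps [a |-> \sum_n a n *: w n] *)

Section Combinations.
Context {R : realType} {k : field_kind}.
Local Notation K := (scalars R k).
Local Notation l2 := (l2 R k).

Lemma sqsum_fin_blocks (V : normedZmodType K) (u : nat -> V) :
  (sqsum u < +oo)%E ->
  exists2 M, 0 <= M & forall m n, \sum_(m <= i < n) rnorm (u i) ^+ 2 <= M ^+ 2.
Proof.
have p0 n : 0 <= rnorm (u n) ^+ 2 by exact: sqr_ge0.
move=> /(nneseries_finP p0)[M uM].
have M0 : 0 <= M by apply: le_trans (uM 0%N); rewrite big_geq.
exists (Num.sqrt M) => [|m n]; first exact: sqrtr_ge0.
rewrite sqr_sqrtr//; apply: le_trans (uM n).
have [mn|nm] := leqP m n; last by rewrite big_geq ?(ltnW nm)// sumr_ge0.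
by rewrite (big_cat_nat (leq0n m) mn)/= lerDr sumr_ge0.
Qed.

Lemma sqsum_tail (V : normedZmodType K) (u : nat -> V) (e : R) : 0 < e ->
  (sqsum u < +oo)%E -> exists N, forall m n, (N <= m)%N ->
    \sum_(m <= i < n) rnorm (u i) ^+ 2 <= e ^+ 2.
Proof.
move=> e0; have p0 n : 0 <= rnorm (u n) ^+ 2 by exact: sqr_ge0.
move=> /(nneseries_finP p0)[M uM].
have [N uN] := nnseries_tail p0 (exprn_gt0 2 e0) uM.
by exists N => m n /uN/ltW.
Qed.

Variable V : normedModType K.
Implicit Types (w : nat -> V).

(** Cauchy-Schwarz on a block of the series: with one factor small on the
blocks far out, it gives convergence, and boundedness and compactness of the
sum. *)
Lemma rnorm_comb_le (a : nat -> K) w (A W : R) (m n : nat) : 0 <= A -> 0 <= W ->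
  \sum_(m <= i < n) rnorm (a i) ^+ 2 <= A ^+ 2 ->
  \sum_(m <= i < n) rnorm (w i) ^+ 2 <= W ^+ 2 ->
  rnorm (\sum_(m <= i < n) a i *: w i) <= A * W.
Proof.
move=> A0 W0 aA wW; apply: le_trans (ler_rnorm_sum _ _ _) _.
under eq_bigr do rewrite rnormZ.
apply: le_trans (cauchy_schwarz_range _ _ _ _) _.
by apply: ler_pM; rewrite ?sqrtr_ge0// -[leRHS]ger0_norm// -sqrtr_sqr ler_wsqrtr.
Qed.

Lemma comb_cvg (a : nat -> K) w : cauchy_complete V ->
  (sqsum a < +oo)%E -> (sqsum w < +oo)%E ->
  cvg (series (fun n => a n *: w n) @ \oo).
Proof.
move=> cV /sqsum_fin_blocks[A A0 aA] wfin; apply: cauchy_seq_cvg => // e e0.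
have A1 : 0 < A + 1 by rewrite ltr_wpDl.
have eA0 : 0 < e / (A + 1) by rewrite divr_gt0.
have [N wN] := sqsum_tail eA0 wfin; exists N => n Nn.
rewrite /series/= (big_cat_nat (leq0n N) Nn)/= addrAC subrr add0r.
apply: le_lt_trans (rnorm_comb_le A0 (ltW eA0) (aA _ _) (wN _ _ (leqnn N))) _.
by rewrite mulrCA gtr_pMr// ltr_pdivrMr// mul1r ltrDl.
Qed.

Lemma comb_tail_le (a : nat -> K) w (y : V) (A W : R) (N : nat) : 0 <= A -> 0 <= W ->
  series (fun n => a n *: w n) @ \oo --> y ->
  (forall n, \sum_(N <= i < n) rnorm (a i) ^+ 2 <= A ^+ 2) ->
  (forall n, \sum_(N <= i < n) rnorm (w i) ^+ 2 <= W ^+ 2) ->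
  rnorm (y - \sum_(0 <= i < N) a i *: w i) <= A * W.
Proof.
move=> A0 W0 ay aA wW; apply: (rdist_lim_le ay); exists N => // n /= Nn.
rewrite /series/= (big_cat_nat (leq0n N) Nn)/= addrAC subrr add0r.
exact: rnorm_comb_le.
Qed.

Lemma comb_linear w : cauchy_complete V -> (sqsum w < +oo)%E ->
  exists B : {linear l2 -> V},
    forall a : l2, series (fun n => coord a n *: w n) @ \oo --> B a.
Proof.
move=> cV wfin.
pose f (a : l2) : V := lim (series (fun n => coord a n *: w n) @ \oo).
have fP (a : l2) : series (fun n => coord a n *: w n) @ \oo --> f a.
  by apply: comb_cvg => //; rewrite sqsum_coord ltry.
have f_lin : linear f.
  move=> l a b; apply: (cvg_lim (@norm_hausdorff _ _)).
  rewrite (_ : series _ = l \*: series (fun n => coord a n *: w n) +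
                          series (fun n => coord b n *: w n)).
    by apply: cvgD; [apply: cvgZl_tmp|]; exact: fP.
  apply/funext => n; rewrite -[RHS]/(l *: (\sum_(0 <= i < n) coord a i *: w i) +
                \sum_(0 <= i < n) coord b i *: w i) scaler_sumr -big_split/=.
  by apply: eq_bigr => i _; rewrite -[LHS]/((l * coord a i + coord b i) *: w i) scalerDl scalerA.
by have [B BE] := linear_of f_lin; exists B => a; rewrite BE.
Qed.

Lemma comb_le (B : {linear l2 -> V}) w :
  (forall a : l2, series (fun n => coord a n *: w n) @ \oo --> B a) ->
  forall W, 0 <= W -> (forall m n, \sum_(m <= i < n) rnorm (w i) ^+ 2 <= W ^+ 2) ->
  forall a : l2, rnorm (B a) <= W * rnorm a.
Proof.
move=> Bw W W0 wW a; rewrite mulrC.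
have := @comb_tail_le _ _ _ _ _ 0 (rnorm_ge0 a) W0 (Bw a).
by rewrite big_geq// subr0; apply => n; [exact: sum_coord_le|exact: wW].
Qed.

Lemma comb_bounded (B : {linear l2 -> V}) w : (sqsum w < +oo)%E ->
  (forall a : l2, series (fun n => coord a n *: w n) @ \oo --> B a) ->
  bounded_map l2 V B.
Proof.
move=> /sqsum_fin_blocks[W W0 wW] Bw; apply/bounded_mapP.
exists (W + 1) => [|a]; first by rewrite ltr_wpDl.
apply: le_trans (comb_le Bw W0 wW a) _.
by rewrite ler_wpM2r ?rnorm_ge0// lerDl.
Qed.

(** By [comb_tail_le] the truncations of the series are finite-rank maps that
converge to [B] uniformly on the unit ball. *)
Lemma comb_compact (B : {linear l2 -> V}) w : cauchy_complete V ->
  (sqsum w < +oo)%E ->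
  (forall a : l2, series (fun n => coord a n *: w n) @ \oo --> B a) ->
  compact_map l2 V B.
Proof.
move=> cV wfin Bw; apply: (@compact_map_approx _ _ _ _ _ (fun n (b : l2) => coord b n) w 1) => //.
  by move=> n a /unit_ballP; apply: le_trans; exact: rnorm_coord_le.
move=> e e0; have e2 : 0 < e / 2 by rewrite divr_gt0.
have [N wN] := sqsum_tail e2 wfin; exists N => a /unit_ballP a1.
apply: (@le_lt_trans _ _ (1 * (e / 2))); last first.
  by rewrite mul1r ltr_pdivrMr// ltr_pMr ?ltr1n.
apply: (comb_tail_le ler01 (ltW e2) (Bw a)) => n; last exact: wN.
apply: (@le_trans _ _ (\sum_(0 <= i < n) rnorm (coord a i) ^+ 2)).
  have sum_ge0 m : 0 <= \sum_(0 <= i < m) rnorm (coord a i) ^+ 2.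
    by apply: sumr_ge0 => i _; exact: sqr_ge0.
  have [Nn|nN] := leqP N n; last by rewrite big_geq ?(ltnW nN).
  by rewrite (big_cat_nat (leq0n N) Nn)/= lerDr.
by apply: le_trans (sum_coord_le a n) _; rewrite ler_pXn2r ?nnegrE ?rnorm_ge0 ?ler01.
Qed.

End Combinations.

(** * The inner product of [l2] *)

Section Conjugation.
Context {R : realType} {k : field_kind}.
Local Notation K := (scalars R k).
Local Notation conj := (conj R k).

Lemma conjB (x y : K) : conj (x - y) = conj x - conj y.
Proof. by rewrite /Defs.conj; case: k x y => //= x y; rewrite rmorphB. Qed.

Lemma conjD (x y : K) : conj (x + y) = conj x + conj y.
Proof. by rewrite /Defs.conj; case: k x y => //= x y; rewrite rmorphD. Qed.

Lemma conjM (x y : K) : conj (x * y) = conj x * conj y.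
Proof. by rewrite /Defs.conj; case: k x y => //= x y; rewrite rmorphM. Qed.

Lemma conjK (x : K) : conj (conj x) = x.
Proof. by rewrite /Defs.conj; case: k x => //= -[a b] /=; rewrite opprK. Qed.

Lemma conj_of_real (x : R) : conj (of_real x) = of_real x.
Proof. by rewrite /Defs.conj; case: k => //=; rewrite oppr0. Qed.

Lemma mul_conj (x : K) : x * conj x = of_real (rnorm x ^+ 2).
Proof.
rewrite expr2 of_realM rnormE /Defs.conj; case: k x => /= x.
  by rewrite -normrM ger0_norm// -expr2 sqr_ge0.
by rewrite -expr2 -sqr_normc.
Qed.

Lemma rnorm_conj (x : K) : rnorm (conj x) = rnorm x.
Proof.
apply/eqP; rewrite -(@eqrXn2 _ 2)// ?rnorm_ge0//; apply/eqP.
by apply: (can_inj (@of_realK R k)); rewrite -!mul_conj conjK mulrC.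
Qed.

Lemma conj_sum (u : nat -> K) m n :
  conj (\sum_(m <= i < n) u i) = \sum_(m <= i < n) conj (u i).
Proof.
apply: (big_morph _ conjD).
by rewrite -(@of_real0 R k) conj_of_real.
Qed.

Lemma cvg_conj (T : Type) (F : set_system T) {FF : Filter F} (f : T -> K^o) (l : K^o) :
  f @ F --> l -> (fun t => conj (f t) : K^o) @ F --> (conj l : K^o).
Proof.
move=> /(@cvg_rnormP R k) fl; apply/(@cvg_rnormP R k) => e /fl.
by apply: filterS => t; rewrite -[conj l - conj (f t)]conjB (rnorm_conj (l - f t)).
Qed.

End Conjugation.

Section L2Dot.
Variables (R : realType) (k : field_kind).
Local Notation K := (scalars R k).
Local Notation l2 := (l2 R k).
Local Notation conj := (conj R k).

Definition l2dot (a b : l2) : K :=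
  lim (series (fun n => (coord a n * conj (coord b n) : K^o)) @ \oo).

Lemma sqsum_conj (b : l2) : sqsum (fun n => conj (coord b n) : K^o) = sqsum (coord b).
Proof. by apply: eq_eseriesr => n _; rewrite rnorm_conj. Qed.

Lemma l2dotP (a b : l2) :
  series (fun n => (coord a n * conj (coord b n) : K^o)) @ \oo --> (l2dot a b : K^o).
Proof.
apply: (@comb_cvg R k K^o (coord a) (fun n => conj (coord b n) : K^o)).
- exact: scalars_complete.
- by rewrite sqsum_coord ltry.
- by rewrite sqsum_conj sqsum_coord ltry.
Qed.

Arguments l2dotP : clear implicits.

(** For fixed [b], the form is the synthesis map of the conjugate of [b], with
values in the scalars. *)
Lemma l2dot_linear (b : l2) : exists B : {linear l2 -> K^o}, l2dot^~ b =1 B.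
Proof.
have bfin : (sqsum (fun n => conj (coord b n) : K^o) < +oo)%E.
  by rewrite sqsum_conj sqsum_coord ltry.
have [B BP] := comb_linear (@scalars_complete R k) bfin.
by exists B => a; exact: (@seq_lim_unique R k K^o _ _ _ (l2dotP a b) (BP a)).
Qed.

Lemma l2dotC (a b : l2) : l2dot a b = conj (l2dot b a).
Proof.
apply: (@seq_lim_unique R k K^o _ _ _ (l2dotP a b)).
rewrite (_ : series _ = fun n =>
    conj (series (fun i => (coord b i * conj (coord a i) : K^o)) n)).
  exact: cvg_conj (l2dotP b a).
apply/funext => n; rewrite /series/= conj_sum; apply: eq_bigr => i _.
by rewrite conjM conjK mulrC.
Qed.

Lemma l2dot_norm (a : l2) : l2dot a a = `|a| ^+ 2.
Proof.
rewrite -rnormE expr2 -of_realM -expr2.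
apply: (@seq_lim_unique R k K^o _ _ _ (l2dotP a a)).
pose S n := \sum_(0 <= i < n) rnorm (coord a i) ^+ 2.
have Sa : S @ \oo --> rnorm a ^+ 2.
  have := @is_cvg_nneseries R (fun n => (rnorm (coord a n) ^+ 2)%:E) predT 0.
  move=> /(_ (fun n _ _ => sqr_ge0 _)); rewrite -[limn _]/(sqsum (coord a)).
  rewrite sqsum_coord => /fine_cvg; rewrite (_ : _ \o _ = S)//.
  by apply/funext => n; rewrite /= sumEFin.
rewrite (_ : series _ = fun n => of_real (S n)).
  apply/(@cvg_rnormP R k) => e e0; move/cvgrPdist_lt : Sa => /(_ e e0).
  apply: filterS => n; rewrite -of_realN -of_realD.
  by rewrite rnorm_of_real.
apply/funext => n; rewrite /series/= /S.
elim: n => [|n IH]; first by rewrite !big_geq ?of_real0.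
by rewrite !big_nat_recr//= IH of_realD mul_conj.
Qed.

Lemma l2dotBl (b : l2) : zmod_morphism (l2dot^~ b).
Proof. by have [B BE] := l2dot_linear b; move=> x y; rewrite !BE linearB. Qed.

Lemma l2dotZl (b : l2) : scalable_for *%R (l2dot^~ b).
Proof. by have [B BE] := l2dot_linear b; move=> l x; rewrite !BE linearZ. Qed.

Lemma l2dotBr (a : l2) : zmod_morphism (l2dot a).
Proof. by move=> x y; rewrite !(l2dotC a) l2dotBl conjB. Qed.

Lemma l2dotZr (a : l2) : scalable_for (conj \; *%R) (l2dot a).
Proof. by move=> l x; rewrite !(l2dotC a) l2dotZl conjM. Qed.

Lemma l2dot_hermitian (a b : l2) : l2dot a b = (-1) ^+ false * conj (l2dot b a).
Proof. by rewrite expr0 mul1r -l2dotC. Qed.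

Lemma l2dot_gt0 (a : l2) : a != 0 -> 0 < l2dot a a.
Proof. by move=> a0; rewrite l2dot_norm exprn_gt0// normr_gt0. Qed.

HB.instance Definition _ := isBilinear.Build K l2 l2 K *%R (conj \; *%R) l2dot
  l2dotBl l2dotBr l2dotZl l2dotZr.
HB.instance Definition _ :=
  isHermitianSesquilinear.Build K l2 false conj l2dot l2dot_hermitian.
HB.instance Definition _ := isDotProduct.Build K l2 l2dot l2dot_gt0.

Lemma l2_hilbert : is_hilbert l2.
Proof. by exists (l2dot : {dot l2 for conj}) => a; rewrite /= l2dot_norm. Qed.

End L2Dot.

(** * Linear lifts through a map defined on a Hilbert space *)

Section HilbertLift.
Context {R : realType} {k : field_kind}.
Local Notation K := (scalars R k).
Local Notation conj := (conj R k).
Variables (H : completeNormedModType K) (dot : {dot H for conj}).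
Hypothesis dot_norm : forall x, `|x| ^+ 2 = dot x x.

Lemma dot_rnorm (x : H) : dot x x = of_real (rnorm x ^+ 2).
Proof. by rewrite -dot_norm expr2 of_realM rnormE. Qed.

Lemma dotC (x y : H) : dot x y = conj (dot y x).
Proof. by rewrite (hermitian_subproof (s := dot)) expr0 mul1r. Qed.

Lemma dotDl (x y z : H) : dot (x + y) z = dot x z + dot y z.
Proof. exact: linearDl. Qed.

Lemma dotBl (x y z : H) : dot (x - y) z = dot x z - dot y z.
Proof. exact: linearBl. Qed.

Lemma dotZl (l : K) (x z : H) : dot (l *: x) z = l * dot x z.
Proof. exact: linearZl_LR. Qed.

Lemma dotDr (x y z : H) : dot z (x + y) = dot z x + dot z y.
Proof. exact: linearDr. Qed.

Lemma dotBr (x y z : H) : dot z (x - y) = dot z x - dot z y.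
Proof. exact: linearBr. Qed.

Lemma dotZr (l : K) (x z : H) : dot z (l *: x) = conj l * dot z x.
Proof. exact: linearZr_LR. Qed.

Lemma parallelogram (x y : H) :
  rnorm (x + y) ^+ 2 + rnorm (x - y) ^+ 2 = 2 * (rnorm x ^+ 2 + rnorm y ^+ 2).
Proof.
apply: (can_inj (@of_realK R k)).
rewrite of_realD of_realM of_real_nat of_realD -!dot_rnorm.
rewrite dotBl !dotBr dotDl !dotDr.
by ring.
Qed.

(** The choice [l = dot a n / |n|^2] decreases the squared norm of [a] by
[|dot a n|^2 / |n|^2]. *)
Lemma minimal_orthogonal (a n : H) :
  (forall l : K, rnorm a <= rnorm (a - l *: n)) -> dot a n = 0.
Proof.
have [->|n0] := eqVneq n 0; first by rewrite linear0r.
have n2 : 0 < rnorm n ^+ 2 by rewrite exprn_gt0// rnorm_gt0.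
set c := dot a n; pose s := (rnorm n ^+ 2)^-1.
move=> /(_ (of_real s * c)); rewrite -(@ler_pXn2r _ 2) ?nnegrE ?rnorm_ge0//.
have -> : rnorm (a - (of_real s * c) *: n) ^+ 2 =
    rnorm a ^+ 2 - s * rnorm c ^+ 2.
  apply: (can_inj (@of_realK R k)).
  rewrite of_realD of_realN -!dot_rnorm of_realM -mul_conj.
  rewrite dotBl !dotBr !dotZl !dotZr.
  rewrite (dotC n a) -/c !dot_rnorm conjM conj_of_real.
  have sn : @of_real R k s * of_real (rnorm n ^+ 2) = 1.
    by rewrite -of_realM mulVf ?of_real1// gt_eqF.
  ring: sn.
rewrite lerBrDr gerDl => /(le_trans _) sc.
apply/rnorm0_eq0/eqP; rewrite -sqrf_eq0 eq_le sqr_ge0 andbT.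
by rewrite -(pmulr_rle0 _ (_ : 0 < s)) ?invr_gt0//; exact: sc.
Qed.

Variables (Y : normedModType K) (B : {linear H -> Y}).
Hypothesis B_bounded : bounded_map H Y B.

(** A sequence of preimages whose norms tend to the infimum is Cauchy by the
parallelogram identity, and its limit is a preimage since [B] is continuous. *)
Lemma minimal_preimage (h : H) : exists2 a, B a = B h &
  forall b, B b = B h -> rnorm a <= rnorm b.
Proof.
pose S := [set rnorm b ^+ 2 | b in [set b | B b = B h]].
have infS : has_inf S.
  by split; [exists (rnorm h ^+ 2); exists h|exists 0 => _ [b _ <-]; exact: sqr_ge0].
have Slb b : B b = B h -> inf S <= rnorm b ^+ 2.
  by move=> Bb; apply: ge_inf; [exact: infS.2|exists b].
have /choice[u uP] (m : nat) : exists b, B b = B h /\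
    rnorm b ^+ 2 < inf S + m.+1%:R^-1.
  have m0 : 0 < m.+1%:R^-1 :> R by rewrite invr_gt0.
  by have [_ [b Bb <-] bm] := inf_adherent m0 infS; exists b.
have u_cvg : cvg (u @ \oo).
  apply: cauchy_seq_cvg; first exact: completeNormedMod_cauchy.
  move=> e e0; pose N := Num.truncn (4 / e ^+ 2).
  have N_small : 4 * N.+1%:R^-1 < e ^+ 2.
    by rewrite ltr_pdivrMr// -ltr_pdivrMl ?exprn_gt0// mulrC truncnS_gt.
  (* for [n >= N] the parallelogram identity bounds the squared distance of
     [u n] to [u N] by four times the excess [N.+1%:R^-1] over the infimum *)
  exists N => n Nn; rewrite -(@ltr_pXn2r _ 2) ?nnegrE ?rnorm_ge0 ?(ltW e0)//.
  apply: le_lt_trans N_small.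
  have [Bn un] := uP n; have [BN uN] := uP N.
  have nN : n.+1%:R^-1 <= N.+1%:R^-1 :> R by rewrite lef_pV2 ?posrE// ler_nat.
  (* the midpoint of two preimages is again a preimage *)
  have mid : 4 * inf S <= rnorm (u n + u N) ^+ 2.
    have /Slb : B (of_real 2^-1 *: (u n + u N)) = B h.
      rewrite linearZ/= linearD Bn BN -{1 2}[B h]scale1r -scalerDl scalerA.
      by rewrite -of_real1 -of_realD -of_realM mulVf// of_real1 scale1r.
    rewrite rnormZ rnorm_of_real ger0_norm ?invr_ge0// exprMn exprVn.
    by rewrite ler_pdivlMl// -natrX.
  have := parallelogram (u n) (u N); move: mid un uN nN.
  by move: (n.+1%:R^-1) (N.+1%:R^-1) => i j; lra.
set a := lim (u @ \oo) in u_cvg.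
exists a => [|b Bb].
  have Bu : (B \o u) @ \oo --> B a by apply: bounded_map_cvg.
  apply: (seq_lim_unique Bu); rewrite (_ : B \o u = cst (B h)).
    exact: cvg_cst.
  by apply/funext => m; exact: (uP m).1.
rewrite -(@ler_pXn2r _ 2) ?nnegrE ?rnorm_ge0//; apply: le_trans (Slb _ Bb).
have ua : (fun m => rnorm (u m) ^+ 2) @ \oo --> rnorm a ^+ 2.
  by have /cvg_rnorm := u_cvg; move=> /[dup]; exact: cvgM.
have uS : (fun m => inf S + harmonic m) @ \oo --> inf S.
  rewrite -[X in _ --> X]addr0; apply: cvgD; first exact: cvg_cst.
  exact: cvg_harmonic.
by apply: (ler_cvg_to ua uS); apply: nearW => m; exact/ltW/(uP m).2.
Qed.

(** The preimage of [T x] of least norm is orthogonal to the kernel of [B]. The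
defect of linearity of this choice lies in the kernel of [B] and is orthogonal
to it, so it vanishes. *)
Lemma hilbert_lift (X : normedModType K) (T : {linear X -> Y}) (M : R) :
  (forall x, exists2 h, B h = T x & rnorm h <= M * rnorm x) ->
  exists2 A : {linear X -> H},
    forall x, B (A x) = T x & forall x, rnorm (A x) <= M * rnorm x.
Proof.
move=> TB.
have /choice[f fP] (x : X) : exists a, [/\ B a = T x, rnorm a <= M * rnorm x &
    forall n, B n = 0 -> dot a n = 0].
  have [h Bh hM] := TB x; have [a Ba amin] := minimal_preimage h.
  exists a; split; [by rewrite Ba|by apply: le_trans hM; exact: amin|].
  move=> n Bn; apply: minimal_orthogonal => l; apply: amin.
  by rewrite linearB linearZ/= Bn scaler0 subr0.
have f_lin : linear f.
  move=> l x y; apply/eqP; rewrite -subr_eq0; apply/eqP.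
  set d := _ - _; have Bd : B d = 0.
    have [Bx _ _] := fP x; have [By _ _] := fP y; have [Bxy _ _] := fP (l *: x + y).
    by rewrite /d linearB linearP Bx By Bxy linearP subrr.
  apply: rnorm0_eq0; apply/eqP; rewrite -sqrf_eq0; apply/eqP.
  apply: (can_inj (@of_realK R k)); rewrite -dot_rnorm of_real0.
  rewrite {1}/d dotBl dotDl dotZl.
  have orth z : dot (f z) d = 0 by have [_ _] := fP z; exact.
  by rewrite !orth mulr0 addr0 subr0.
by have [A AE] := linear_of f_lin; exists A => x; rewrite AE; have [] := fP x.
Qed.

End HilbertLift.

(** * Compact diagonal maps *)

(** With [t n] a positive sequence that decreases to zero and whose decrements
dominate [s], take [d n = (t n)^(1/4)]. Then
[s n / d n ^+ 2 <= (t n - t n.+1) / sqrt (t n) <= 2 (sqrt (t n) - sqrt (t n.+1))],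
and the right-hand side telescopes. *)
Lemma vanishing_weights (R : realType) (s : nat -> R) (M : R) :
  (forall n, 0 <= s n) -> (forall N, \sum_(0 <= n < N) s n <= M) ->
  exists d : nat -> R, [/\ forall n, 0 < d n,
    exists D, forall n, d n <= D,
    forall e, 0 < e -> exists N, forall n, (N <= n)%N -> d n <= e &
    exists D, forall N, \sum_(0 <= n < N) s n / d n ^+ 2 <= D].
Proof.
move=> s0 sM; pose S := [set \sum_(0 <= n < N) s n | N in setT].
have supS : has_sup S.
  by split; [exists (\sum_(0 <= n < 0) s n); exists 0%N|exists M => _ [N _ <-]].
(* a tail of the series, plus a term that keeps it positive when [s] is
   eventually zero *)
pose t n := sup S - \sum_(0 <= i < n) s i + n.+1%:R^-1.
have sum_le n : \sum_(0 <= i < n) s i <= sup S.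
  by apply: sup_upper_bound => //; exists n.
have t_gt0 n : 0 < t n by rewrite ltr_wpDl ?subr_ge0// invr_gt0.
have s_le n : s n <= t n - t n.+1.
  have : n.+2%:R^-1 <= n.+1%:R^-1 :> R by rewrite lef_pV2 ?posrE// ler_nat.
  by rewrite /t big_nat_recr//=; move: n.+1%:R^-1 n.+2%:R^-1 => i j; lra.
have t_noninc n m : (n <= m)%N -> t m <= t n.
  elim: m => [|m IH]; first by rewrite leqn0 => /eqP ->.
  rewrite leq_eqVlt => /predU1P[->//|/IH]; apply: le_trans.
  by rewrite -subr_ge0; exact: le_trans (s_le m).
pose q n := Num.sqrt (t n).
have q_gt0 n : 0 < q n by rewrite sqrtr_gt0.
have qq n : q n ^+ 2 = t n by rewrite sqr_sqrtr// ltW.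
have q_noninc n m : (n <= m)%N -> q m <= q n.
  by move=> nm; rewrite ler_wsqrtr// t_noninc.
exists (fun n => Num.sqrt (q n)); split=> [n| |e e0|].
- by rewrite sqrtr_gt0.
- by exists (Num.sqrt (q 0%N)) => n; rewrite ler_wsqrtr// q_noninc.
- have e4 : 0 < e ^+ 4 / 2 by rewrite divr_gt0// exprn_gt0.
  have [_ [N1 _ <-] N1S] := sup_adherent e4 supS.
  pose N2 := Num.truncn (e ^+ 4 / 2)^-1; exists (maxn N1 N2) => n Nn.
  have tn : t n <= e ^+ 4.
    apply: le_trans (t_noninc _ _ Nn) _; rewrite /t.
    have : \sum_(0 <= i < N1) s i <= \sum_(0 <= i < maxn N1 N2) s i.
      by rewrite (big_cat_nat (leq0n N1) (leq_maxl _ _))/= lerDl sumr_ge0.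
    have : (maxn N1 N2).+1%:R^-1 <= e ^+ 4 / 2.
      rewrite -[leRHS]invrK lef_pV2 ?posrE ?invr_gt0//.
      apply: le_trans (ltW (truncnS_gt _)) _.
      by rewrite ler_nat ltnS leq_maxr.
    by move: N1S; move: ((maxn N1 N2).+1%:R^-1) => i; lra.
  rewrite -(ger0_norm (ltW e0)) -sqrtr_sqr ler_wsqrtr//.
  rewrite -(ger0_norm (sqr_ge0 e)) -sqrtr_sqr ler_wsqrtr//.
  by rewrite -exprM.
- exists (2 * q 0%N) => N; apply: (@le_trans _ _ (2 * (q 0%N - q N))); last first.
    by rewrite ler_pM2l// gerBl ltW.
  elim: N => [|N IH]; first by rewrite big_geq// subrr mulr0.
  rewrite big_nat_recr//=.
  have : s N / Num.sqrt (q N) ^+ 2 <= 2 * (q N - q N.+1).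
    rewrite (sqr_sqrtr (ltW (q_gt0 N))) ler_pdivrMr//.
    have := s_le N; rewrite -!qq; have := q_noninc _ _ (leqnSn N).
    have := q_gt0 N; have := q_gt0 N.+1; nra.
  move: IH; lra.
Qed.

Section Diagonal.
Context {R : realType} {k : field_kind}.
Local Notation K := (scalars R k).
Local Notation l2 := (l2 R k).

Lemma coord_sum (u : nat -> l2) N m :
  coord (\sum_(0 <= n < N) u n) m = \sum_(0 <= n < N) coord (u n) m.
Proof. by apply: (big_morph (fun a : l2 => coord a m)) => // a b; rewrite coordD. Qed.

Lemma unit_vector (n : nat) : exists e : l2, forall m, coord e m = (m == n)%:R.
Proof.
apply: (@l2_of_seq _ _ _ 1) => N.
suff -> : \sum_(0 <= m < N) rnorm ((m == n)%:R : K) ^+ 2 = (n < N)%:R.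
  by rewrite lern1 leq_b1.
elim: N => [|N IH]; first by rewrite big_geq.
rewrite big_nat_recr//= IH -of_real_nat rnorm_of_real ltnS.
by case: ltngtP => _; rewrite ?normr0 ?normr1 ?expr0n ?expr1n ?addr0 ?add0r.
Qed.

Lemma diagonal_linear (d : nat -> R) (D : R) : (forall n, 0 <= d n <= D) ->
  exists T : {linear l2 -> l2}, forall a n, coord (T a) n = of_real (d n) * coord a n.
Proof.
move=> dD; have /choice[f fP] (a : l2) : exists b : l2,
    forall n, coord b n = of_real (d n) * coord a n.
  apply: (@l2_of_seq _ _ _ (D ^+ 2 * rnorm a ^+ 2)) => N.
  apply: le_trans (ler_wpM2l (sqr_ge0 D) (sum_coord_le a N)).
  rewrite mulr_sumr; apply: ler_sum => n _; rewrite rnormM exprMn rnorm_of_real.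
  have /andP[d0 dDn] := dD n; rewrite ler_wpM2r ?sqr_ge0// ger0_norm//.
  by rewrite ler_pXn2r ?nnegrE// (le_trans d0).
have coord_inj (a b : l2) : (forall n, coord a n = coord b n) -> a = b.
  by move=> ab; apply/val_inj/funext.
have f_lin : linear f.
  move=> l a b; apply: coord_inj => n; rewrite coordD coordZ !fP coordD coordZ.
  by rewrite mulrDr mulrCA.
by have [T TE] := linear_of f_lin; exists T => a n; rewrite TE.
Qed.

(** Truncating the diagonal at [N] changes the map by at most
[sup_(n >= N) d n] in norm. *)
Lemma diagonal_compact (T : {linear l2 -> l2}) (d : nat -> R) (D : R) :
  (forall n, 0 <= d n <= D) ->
  (forall e, 0 < e -> exists N, forall n, (N <= n)%N -> d n <= e) ->
  (forall a n, coord (T a) n = of_real (d n) * coord a n) ->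
  compact_map l2 l2 T.
Proof.
move=> dD d0 Td; have /choice[u uP] := unit_vector.
apply: (@compact_map_approx _ _ _ _ _ (fun n (a : l2) => of_real (d n) * coord a n) u D).
- exact: l2_complete.
- move=> n a /unit_ballP a1; rewrite rnormM rnorm_of_real.
  have /andP[dn0 dDn] := dD n; rewrite ger0_norm// -[leRHS]mulr1.
  by rewrite ler_pM ?rnorm_ge0// (le_trans (rnorm_coord_le a n)).
move=> e e0; have e2 : 0 < e / 2 by rewrite divr_gt0.
have [N dN] := d0 _ e2; exists N => a /unit_ballP a1.
apply: (@le_lt_trans _ _ (e / 2)); last by rewrite ltr_pdivrMr// ltr_pMr ?ltr1n.
apply: l2_rnorm_le => [|L]; first exact: ltW.
apply: (@le_trans _ _ ((e / 2) ^+ 2 * rnorm a ^+ 2)); last first.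
  by rewrite ler_piMr ?sqr_ge0// expr_le1 ?rnorm_ge0.
apply: le_trans (ler_wpM2l (sqr_ge0 _) (sum_coord_le a L)).
rewrite mulr_sumr; apply: ler_sum => m _.
rewrite coordB coord_sum Td.
under eq_bigr do rewrite coordZ uP.
have [mN|Nm] := ltnP m N.
  rewrite (bigD1_seq m) ?mem_index_iota ?iota_uniq//= eqxx mulr1 big1.
    by rewrite addr0 subrr rnorm0 expr0n mulr_ge0 ?sqr_ge0.
  by move=> i im; rewrite eq_sym (negbTE im) mulr0.
rewrite big_nat big1 ?subr0; last first.
  by move=> i /andP[_ iN]; rewrite gtn_eqF ?mulr0// (leq_trans iN).
rewrite rnormM exprMn rnorm_of_real ler_wpM2r ?sqr_ge0//.
have /andP[dm0 _] := dD m; rewrite ger0_norm//.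
by rewrite ler_pXn2r ?nnegrE ?(ltW e2)// dN.
Qed.

End Diagonal.

(** * The three inclusions *)

Section Inclusions.
Context {R : realType} {k : field_kind}.
Local Notation K := (scalars R k).

Lemma rnorm_opnorm_le (X Y : normedModType K) (T : {linear X -> Y}) (x : X) :
  bounded_map X Y T -> unit_ball X x -> rnorm (T x) <= opnorm T.
Proof.
move=> /bounded_mapP[M M0 TM] Bx; apply: sup_upper_bound; last by exists x.
split; first by exists (rnorm (T x)), x.
exists M => _ [y /unit_ballP y1 <-]; apply: le_trans (TM y) _.
by rewrite ler_piMr// ltW.
Qed.

(** With [F n] the norm of [f n] and [g n] the square root of [F n * |y n|], the
coefficients are [f n x * g n / (F n * c)], of modulus at most [g n / c] for [x]
in the unit ball, and the vectors are [(F n * c / g n) *: y n], of norm [c * g n]. The constant [c],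
with [c ^+ 2 > \sum_n g n ^+ 2], normalizes the coefficients. When [F n] or [g n]
is zero, the inverse of zero being zero makes the [n]-th term vanish, as it
should. *)
Lemma nuclear_two_compact (X Y : normedModType K) (T : {linear X -> Y}) :
  nuclear_map X Y T -> two_compact_map X Y T.
Proof.
move=> [T_bounded [f [y [f_bounded fy_fin Tfy]]]]; split=> //.
pose F n := opnorm (f n).
have fF n x : unit_ball X x -> rnorm (f n x) <= F n.
  exact: (@rnorm_opnorm_le X K^o).
have F0 n : 0 <= F n.
  apply: le_trans (fF n 0 _); first exact: rnorm_ge0.
  by apply/unit_ballP; rewrite rnorm0.
pose p n := F n * rnorm (y n).
have p0 n : 0 <= p n by rewrite mulr_ge0// rnorm_ge0.
have [M pM] := iffLR (nneseries_finP p0) fy_fin.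
have M0 : 0 <= M by apply: le_trans (pM 0%N); rewrite big_geq.
pose g n := Num.sqrt (p n); have gg n : g n ^+ 2 = p n by rewrite sqr_sqrtr.
pose c := Num.sqrt (M + 1).
have M1 : 0 < M + 1 by rewrite ltr_wpDl.
have c0 : 0 < c by rewrite sqrtr_gt0.
have cc : c ^+ 2 = M + 1 by rewrite sqr_sqrtr// ltW.
exists (fun n => of_real (F n * c / g n) *: y n).
  apply/nneseries_finP; first by move=> n; exact: sqr_ge0.
  exists ((M + 1) * M) => N; apply: le_trans (ler_wpM2l (ltW M1) (pM N)).
  rewrite mulr_sumr; apply: ler_sum => n _.
  rewrite rnormZ rnorm_of_real exprMn real_normK ?num_real// -cc.
  have [g0|g0] := eqVneq (g n) 0.
    by rewrite g0 invr0 mulr0 expr0n mul0r mulr_ge0 ?sqr_ge0.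
  have -> : (F n * c / g n) ^+ 2 * rnorm (y n) ^+ 2 = c ^+ 2 * (p n ^+ 2 / g n ^+ 2).
    by rewrite /p; field.
  by rewrite gg expr2 mulfK// -gg sqrf_eq0.
move=> _ [x Bx <-]; exists (fun n => f n x * of_real (g n / (F n * c))).
  apply/nneseries_leP => [n|N]; first exact: sqr_ge0.
  apply: (@le_trans _ _ ((M + 1)^-1 * M)); last first.
    by rewrite mulrC ler_pdivrMr// mul1r lerDl.
  apply: le_trans (ler_wpM2l _ (pM N)); last by rewrite invr_ge0 ltW.
  rewrite mulr_sumr; apply: ler_sum => n _.
  rewrite rnormM rnorm_of_real exprMn real_normK ?num_real// -gg -cc.
  have [F_0|F_0] := eqVneq (F n) 0.
    by rewrite F_0 mul0r invr0 mulr0 expr0n mulr0 mulr_ge0 ?invr_ge0 ?sqr_ge0.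
  apply: (@le_trans _ _ (F n ^+ 2 * (g n / (F n * c)) ^+ 2)).
    by rewrite ler_wpM2r ?sqr_ge0// ler_pXn2r ?nnegrE ?rnorm_ge0// fF.
  by rewrite le_eqVlt; apply/orP; left; apply/eqP; field; rewrite F_0 gt_eqF.
rewrite (_ : (fun n => _) = (fun n => f n x *: y n)) ?Tfy//.
apply/funext => n; rewrite scalerA -[_ * of_real _ * _]mulrA -of_realM.
have [p_0|p_0] := eqVneq (p n) 0; last first.
  have F_0 : F n != 0 by apply: contra_neq p_0 => F_0; rewrite /p F_0 mul0r.
  have g_0 : g n != 0 by apply: contra_neq p_0 => g_0; rewrite -gg g_0 expr0n.
  rewrite (_ : _ / _ * _ = 1) ?of_real1 ?mulr1//.
  by field; rewrite F_0 g_0 gt_eqF.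
move/eqP: p_0; rewrite mulf_eq0 => /orP[/eqP F_0|/eqP/rnorm0_eq0 ->].
  have -> : f n x = 0.
    by apply: rnorm0_eq0; apply/eqP; rewrite eq_le rnorm_ge0 -F_0 fF.
  by rewrite mul0r !scale0r.
by rewrite !scaler0.
Qed.

Lemma two_compact_pietsch (X : normedModType K) (Y : completeNormedModType K)
    (T : {linear X -> Y}) :
  two_compact_map X Y T -> pietsch_two_compact_map X Y T.
Proof.
move=> [T_bounded [z zfin Tz]]; split=> //.
have cY := @completeNormedMod_cauchy R k Y.
have [B0 B0z] := comb_linear cY zfin.
have B0_bounded := comb_bounded zfin B0z.
have [dot dot_norm] := l2_hilbert R k.
(* the hypothesis on the unit ball, extended to all [x] by homogeneity *)
have lift x : exists2 h : l2 R k, B0 h = T x & rnorm h <= 1 * rnorm x.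
  have [->|x0] := eqVneq x 0.
    by exists 0; rewrite ?linear0 ?rnorm0 ?mulr0.
  have nx := rnorm_gt0 x0.
  pose x1 : X := of_real (rnorm x)^-1 *: x.
  have Bx1 : unit_ball X x1.
    apply/unit_ballP; rewrite rnormZ rnorm_of_real ger0_norm ?invr_ge0 ?(ltW nx)//.
    by rewrite mulVf ?gt_eqF.
  have [|a a1 aT] := Tz (T x1); first by exists x1.
  have aN := iffLR (nneseries_leP (fun n => sqr_ge0 _) _) a1.
  have [h hE] := l2_of_seq aN.
  have h1 : rnorm h <= 1.
    by apply: l2_rnorm_le => // N; under eq_bigr do rewrite hE; rewrite expr1n.
  exists (of_real (rnorm x) *: h).
    have B0h : B0 h = T x1.
      apply: (seq_lim_unique (B0z h)); rewrite (_ : (fun n => _) = fun n => a n *: z n)//.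
      by apply/funext => n; rewrite hE.
    rewrite linearZ/= B0h -linearZ/= /x1 scalerA -of_realM mulfV ?gt_eqF//.
    by rewrite of_real1 scale1r.
  by rewrite rnormZ rnorm_of_real ger0_norm ?(ltW nx)// mulrC ler_wpM2r ?(ltW nx).
have [A0 A0T A01] := hilbert_lift dot_norm B0_bounded lift.
have p0 n : 0 <= rnorm (z n) ^+ 2 by exact: sqr_ge0.
have [M zM] := iffLR (nneseries_finP p0) zfin.
have [d [d_gt0 [D dD] d_small [W wW]]] := vanishing_weights p0 zM.
have dD' n : 0 <= d n <= D by rewrite (ltW (d_gt0 n)) dD.
have [S Sd] := @diagonal_linear R k d D dD'.
pose w n := of_real (d n)^-1 *: z n.
have wfin : (sqsum w < +oo)%E.
  apply/nneseries_finP; first by move=> n; exact: sqr_ge0.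
  exists W => N; apply: le_trans (wW N); apply: ler_sum => n _.
  by rewrite rnormZ rnorm_of_real exprMn real_normK ?num_real// exprVn mulrC.
have [B Bw] := comb_linear cY wfin.
exists (S \o A0), B; split.
- apply: precompact_subset (diagonal_compact dD' d_small Sd).
  move=> _ [x /unit_ballP x1 <-]; exists (A0 x) => //; apply/unit_ballP.
  by apply: le_trans (A01 x) _; rewrite mul1r.
- exact: comb_compact Bw.
- move=> x; rewrite -A0T; apply: (seq_lim_unique (B0z (A0 x))).
  rewrite (_ : (fun n => _) = fun n => coord (S (A0 x)) n *: w n); first exact: Bw.
  apply/funext => n; rewrite Sd /w scalerA mulrAC -of_realM mulfV ?gt_eqF//.
  by rewrite of_real1 mul1r.
Qed.

Lemma pietsch_hilbertian (X Y : normedModType K) (T : {linear X -> Y}) :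
  pietsch_two_compact_map X Y T -> hilbertian_map X Y T.
Proof.
move=> [T_bounded [A [B [cA cB TBA]]]]; split=> //.
exists (l2 R k : completeNormedModType K), A, B; split=> //.
- exact: l2_hilbert.
- exact: compact_map_bounded.
- exact: compact_map_bounded.
Qed.

End Inclusions.

Theorem proposition4p11 (R : realType) (k : field_kind)
    (X Y : completeNormedModType (scalars R k)) :
  [/\ nuclear_map X Y `<=` two_compact_map X Y,
      two_compact_map X Y `<=` pietsch_two_compact_map X Y &
      pietsch_two_compact_map X Y `<=` hilbertian_map X Y].
Proof.
split=> T; first exact: nuclear_two_compact.
  exact: two_compact_pietsch.
exact: pietsch_hilbertian.
Qed.
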